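(* Let $P$ be a non-constant polynomial with complex coefficients. Then the only limit point (in $\widehat{\mathbb{C}}$) of the set of critical values of the entire function $e^z+P(z)$ is $\infty$. Consequently, for every complex number $a$, the only limit point (in $\widehat{\mathbb{C}}$) of the set of critical values of the meromorphic function $\frac{1}{e^z+P(z)}+a$ is $a$.
   Context: Here $\widehat{\mathbb{C}}=\mathbb{C}\cup\{\infty\}$. A critical point of an entire function $f$ is a point $z_0\in\mathbb{C}$ with $f'(z_0)=0$; for a meromorphic function, multiple poles are also critical points (with image $\infty$). A critical value is the image of a critical point under the function. *)

(* Defs.v *)
From mathcomp Require Import all_boot all_order all_algebra.
From mathcomp Require Import all_classical all_reals all_analysis.
From mathcomp Require Import complex.

Set Implicit Arguments.
Unset Strict Implicit.
Unset Printing Implicit Defensive.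

Import Order.TTheory GRing.Theory Num.Theory.
Import numFieldNormedType.Exports.

Local Open Scope classical_set_scope.
Local Open Scope ring_scope.
Local Open Scope complex_scope.

(* [R[i]] packed as a [numClosedFieldType]: the norm and topology instances are
   keyed on the structure projection and are not found on the bare [R[i]].
   Hence [is_derive z 1 f l], for [f : Cplx R -> Cplx R], is complex
   differentiability, the difference quotient being taken over complex
   increments. *)
Definition Cplx (R : realType) : numClosedFieldType := R[i].

Definition sphere (R : realType) : topologicalType :=
  one_point_compactification (Cplx R).

Definition fin_pt (R : realType) (w : Cplx R) : sphere R := Some w.

Definition infty_pt (R : realType) : sphere R := None.

Definition expC (R : realType) (z : Cplx R) : Cplx R :=
  (expR (complex.Re z) * cos (complex.Im z))
    +i* (expR (complex.Re z) * sin (complex.Im z)).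

(* [is_derive] includes differentiability; the total ['D_1 f z = 0] would not. *)
Definition critical_points (R : realType) (f : Cplx R -> Cplx R) :
    set (Cplx R) :=
  [set z : Cplx R | is_derive z (1 : Cplx R) f 0].

(* Viewed in the sphere, where limit points are taken. *)
Definition critical_values (R : realType) (f : Cplx R -> Cplx R) :
    set (sphere R) :=
  [set fin_pt (f z) | z in critical_points f].

Definition holomorphic_at (R : realType) (h : Cplx R -> Cplx R) (z : Cplx R) :
    Prop :=
  \forall w \near nbhs z, derivable h w (1 : Cplx R).

Definition pole_of_order (R : realType) (g : Cplx R -> sphere R) (m : nat)
    (z : Cplx R) : Prop :=
  [/\ (0 < m)%N, g z = infty_pt R &
    exists h : Cplx R -> Cplx R,
      [/\ holomorphic_at h z, h z != 0 &
        \forall w \near z^', g w = fin_pt (h w / (w - z) ^+ m)]].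

Definition multiple_pole (R : realType) (g : Cplx R -> sphere R)
    (z : Cplx R) : Prop :=
  exists2 m : nat, (1 < m)%N & pole_of_order g m z.

(* A point where a sphere-valued function is finite is tested through a
   complex-valued function with which it agrees near the point. *)
Definition mero_critical_points (R : realType) (g : Cplx R -> sphere R) :
    set (Cplx R) :=
  [set z : Cplx R | (exists f : Cplx R -> Cplx R,
             (\forall w \near nbhs z, g w = fin_pt (f w)) /\
             critical_points f z)
           \/ multiple_pole g z].

Definition mero_critical_values (R : realType) (g : Cplx R -> sphere R) :
    set (sphere R) :=
  g @` mero_critical_points g.

Definition exp_plus_poly (R : realType) (P : {poly Cplx R}) (z : Cplx R) :
    Cplx R :=
  expC z + P.[z].

(* The function 1 / f + a, with value infinity at the zeros of [f]. *)
Definition recip_plus (R : realType) (f : Cplx R -> Cplx R) (a z : Cplx R) :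
    sphere R :=
  if f z == 0 then infty_pt R else fin_pt ((f z)^-1 + a).

(* Main.v *)
Require Import Defs.
From mathcomp Require Import all_boot all_order all_algebra.
From mathcomp Require Import all_classical all_reals all_analysis.
From mathcomp Require Import complex ring lra.

(** Write f = e^z + P and g = f' = e^z + P'. The critical points of f are the
    zeros of g, and at such a zero f takes the value (P - P')(z). As P - P' is
    a non-constant polynomial, it tends to infinity with z. Hence both claims
    come down to two facts on the zeros of g: there are finitely many in every
    disc ([finite_zeros_in_disc]), and there are some arbitrarily far from the
    origin ([far_zeros]). They say that the set V of critical values of f is
    unbounded and meets every disc in a finite set, so V accumulates at
    infinity and nowhere else ([limit_point_infty]). The critical values of
    1 / f + a are the numbers 1 / v + a with v a nonzero element of V, and
    possibly infinity (at multiple poles). The map v |-> 1 / v + a sends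
    infinity to a, whence the second claim ([limit_point_recip]). The value
    infinity does not become a limit point because 0 is not a limit point
    of V.

    Both facts on zeros rest on one expansion ([local_expansion]): near every
    point z, an exponential polynomial e^z + Q satisfies
    g (h + z) = g z + c h^n + O(h^(n+1)) with n > 0 and c != 0. It follows from
    the Taylor estimate of the exponential ([taylor_bound]), since e^z times a
    Taylor polynomial of degree greater than that of Q cannot cancel against Q.
    The expansion shows that zeros are isolated, whence finiteness in a disc by
    compactness. It also shows that |g| has no local minimum besides the zeros
    of g ([modulus_not_minimal], the minimum modulus principle).

    For the existence of far zeros, let a = 2 pi i k with k large and choose w0
    with e^w0 = - Q(a). As log |Q(a)| = o(|a|), the point w0 + a is relatively
    close to a, and Q is nearly constant, equal to Q(a), around it. Hence near
    w0 + a the function g is close to Q(a) (1 - e^h), with h the displacement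
    from w0 + a. This is small at h = 0 and not small on a circle
    around 0, so the minimum of |g| on the disc is attained inside, and it is a
    zero of g. *)

Set Implicit Arguments.
Unset Strict Implicit.
Unset Printing Implicit Defensive.

Import Order.TTheory GRing.Theory Num.Theory.
Import numFieldNormedType.Exports.

Local Open Scope classical_set_scope.
Local Open Scope ring_scope.

(** * The real-valued modulus *)

(** The norm of [Cplx R] takes its values in [Cplx R], whose order is partial.
    All estimates below are made with this real-valued version, so that they
    live in a totally ordered field. *)
Definition modulus (R : realType) (z : Cplx R) : R := complex.Re `|z|.

Definition ofR (R : realType) (x : R) : Cplx R := x%:C%C.

Lemma modulusE (R : realType) (z : Cplx R) : ofR (modulus z) = `|z|.
Proof. by rewrite /modulus normc_def. Qed.

Lemma ofR_le (R : realType) (x y : R) : (ofR x <= ofR y) = (x <= y).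
Proof. exact: lecR. Qed.

Lemma ofR_lt (R : realType) (x y : R) : (ofR x < ofR y) = (x < y).
Proof. exact: ltcR. Qed.

Lemma ofRM (R : realType) (x y : R) : ofR (x * y) = ofR x * ofR y.
Proof. exact: rmorphM. Qed.

Lemma ofRD (R : realType) (x y : R) : ofR (x + y) = ofR x + ofR y.
Proof. exact: rmorphD. Qed.

Lemma ofR_inj (R : realType) : injective (@ofR R).
Proof. by move=> x y []. Qed.

Lemma modulus_ge0 (R : realType) (z : Cplx R) : 0 <= modulus z.
Proof. by rewrite -ofR_le modulusE; exact: normr_ge0. Qed.

Lemma modulusM (R : realType) (z w : Cplx R) :
  modulus (z * w) = modulus z * modulus w.
Proof. by apply: ofR_inj; rewrite ofRM !modulusE normrM. Qed.

Lemma modulusD (R : realType) (z w : Cplx R) :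
  modulus (z + w) <= modulus z + modulus w.
Proof. by rewrite -ofR_le ofRD !modulusE ler_normD. Qed.

Lemma modulusN (R : realType) (z : Cplx R) : modulus (- z) = modulus z.
Proof. by rewrite /modulus normrN. Qed.

Lemma modulusB (R : realType) (z w : Cplx R) :
  modulus z - modulus w <= modulus (z - w).
Proof.
by rewrite lerBlDr; apply: le_trans (modulusD _ _); rewrite subrK.
Qed.

Lemma modulusC (R : realType) (z w : Cplx R) :
  modulus (z - w) = modulus (w - z).
Proof. by rewrite -modulusN opprB. Qed.

Lemma modulus0 (R : realType) : modulus (0 : Cplx R) = 0.
Proof. by rewrite /modulus normr0. Qed.

Lemma modulus1 (R : realType) : modulus (1 : Cplx R) = 1.
Proof. by rewrite /modulus normr1. Qed.

Lemma modulusX (R : realType) (z : Cplx R) n :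
  modulus (z ^+ n) = modulus z ^+ n.
Proof.
by elim: n => [|n ih]; rewrite ?expr0 ?modulus1// !exprS modulusM ih.
Qed.

Lemma modulus_eq0 (R : realType) (z : Cplx R) : (modulus z == 0) = (z == 0).
Proof.
apply/eqP/eqP => [z0|->]; last exact: modulus0.
by apply/eqP; rewrite -normr_eq0 -modulusE z0.
Qed.

Lemma modulus_gt0 (R : realType) (z : Cplx R) : (0 < modulus z) = (z != 0).
Proof. by rewrite lt_def modulus_ge0 andbT modulus_eq0. Qed.

Lemma modulusV (R : realType) (z : Cplx R) : modulus z^-1 = (modulus z)^-1.
Proof.
have [->|z0] := eqVneq z 0; first by rewrite invr0 modulus0 invr0.
apply: (mulfI (x := modulus z)); first by rewrite modulus_eq0.
by rewrite -modulusM !divff ?modulus1 ?modulus_eq0.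
Qed.

Lemma modulus_ofR (R : realType) (x : R) : modulus (ofR x) = `|x|.
Proof. by rewrite /modulus normc_def /= expr0n addr0 sqrtr_sqr. Qed.

Lemma Re_le_modulus (R : realType) (z : Cplx R) :
  `|complex.Re z| <= modulus z.
Proof. by rewrite -ofR_le modulusE; exact: normc_ge_Re. Qed.

Lemma sqr_modulus (R : realType) (z : Cplx R) :
  modulus z ^+ 2 = complex.Re z ^+ 2 + complex.Im z ^+ 2.
Proof.
by rewrite /modulus normc_def /= sqr_sqrtr// addr_ge0// sqr_ge0.
Qed.

(** Replaces the complex radii of the balls of [Cplx R] by real ones. *)
Lemma nbhs_modulusP (R : realType) (z : Cplx R) (U : set (Cplx R)) :
  nbhs z U <-> exists2 e : R, 0 < e & forall w, modulus (w - z) < e -> U w.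
Proof.
split=> [/nbhs_ballP[e /= e0 zU]|[e e0 zU]].
  have eR : ofR (complex.Re e) = e by apply/RRe_real/gtr0_real.
  exists (complex.Re e); first by rewrite -ofR_lt eR.
  move=> w wz; apply: zU.
  by rewrite -ball_normE /= -eR -modulusE ofR_lt modulusC.
apply/nbhs_ballP; exists (ofR e) => /=; first by rewrite (ofR_lt 0).
move=> w; rewrite -ball_normE /= -modulusE ofR_lt => wz.
by apply: zU; rewrite modulusC.
Qed.

(** * The complex exponential and its Taylor polynomials *)

Lemma expCD (R : realType) (z w : Cplx R) : expC (z + w) = expC z * expC w.
Proof.
case: z => a b; case: w => c d; rewrite /expC /= expRD cosD sinD.
apply/eqP; rewrite eq_complex /=; apply/andP; split; apply/eqP; ring.
Qed.

Lemma modulus_expC (R : realType) (z : Cplx R) :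
  modulus (expC z) = expR (complex.Re z).
Proof.
apply/eqP; rewrite -(@eqrXn2 _ 2)// ?modulus_ge0 ?expR_ge0// sqr_modulus /=.
by rewrite !exprMn -mulrDr cos2Dsin2 mulr1.
Qed.

Lemma expC_neq0 (R : realType) (z : Cplx R) : expC z != 0.
Proof. by rewrite -modulus_gt0 modulus_expC expR_gt0. Qed.

Lemma expC0 (R : realType) : expC (0 : Cplx R) = 1.
Proof. by rewrite /expC /= expR0 cos0 sin0 mulr1 mulr0. Qed.

Definition exp_taylor (R : realType) n : {poly Cplx R} :=
  \poly_(k < n) (k`!%:R)^-1.

Lemma deriv_exp_taylor (R : realType) n :
  (exp_taylor R n.+1)^`() = exp_taylor R n.
Proof.
apply/polyP => k; rewrite coef_deriv !coef_poly ltnS.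
case: ifP => _; last by rewrite mul0rn.
by rewrite factS natrM invfM -[LHS]mulr_natr mulrAC mulVf ?mul1r// pnatr_eq0.
Qed.

(** Along the real ray s |-> s h, the scalar functions s |-> Re (c F(s h)) have
    derivative Re (c h F'(s h)): differentiation multiplies the weight [c] by
    [h]. This form lets the mean value theorem for real functions act on
    complex ones. *)
Lemma is_derive_Re_horner (R : realType) (p : {poly Cplx R}) (c h : Cplx R)
    (t : R) :
  is_derive t 1 (fun s : R => complex.Re (c * p.[ofR s * h]))
    (complex.Re (c * h * p^`().[ofR t * h])).
Proof.
elim/poly_ind: p c => [|p a ih] c.
  rewrite deriv0 !horner0 mulr0 /=.
  under eq_fun do rewrite horner0 mulr0 /=.
  exact: is_derive_cst.
have -> : (fun s : R => complex.Re (c * (p * 'X + a%:P).[ofR s * h])) =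
    (fun s : R => s * complex.Re (c * h * p.[ofR s * h]) + complex.Re (c * a)).
  apply/funext => s; rewrite !hornerE.
  case: c {ih} => c1 c2; case: h => h1 h2; case: a => a1 a2.
  by case: (p.[_]) => p1 p2 /=; ring.
apply: is_derive_eq.
rewrite addr0 derivD derivM derivX derivC !hornerE.
rewrite /GRing.scale /=.
case: c {ih} => c1 c2; case: h => h1 h2.
by case: (p.[_]) => p1 p2; case: (p^`().[_]) => q1 q2 /=; ring.
Qed.

Lemma is_derive_Re_expC (R : realType) (c h : Cplx R) (t : R) :
  is_derive t 1 (fun s : R => complex.Re (c * expC (ofR s * h)))
    (complex.Re (c * h * expC (ofR t * h))).
Proof.
case: c => c1 c2; case: h => x y.
have -> : (fun s : R => complex.Re ((c1 +i* c2)%C * expC (ofR s * (x +i* y)%C)))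
   = (fun s : R => expR (s * x) * (c1 * cos (s * y) - c2 * sin (s * y))).
  by apply/funext => s; rewrite /expC /= !mul0r subr0 addr0; ring.
apply: is_derive_eq.
rewrite /GRing.scale /= !mul0r subr0 !addr0; ring.
Qed.

Lemma is_derive_Re_taylor (R : realType) n (c h : Cplx R) (t : R) :
  is_derive t 1
    (fun s : R =>
       complex.Re (c * (expC (ofR s * h) - (exp_taylor R n.+1).[ofR s * h])))
    (complex.Re (c * h * (expC (ofR t * h) - (exp_taylor R n).[ofR t * h]))).
Proof.
have ReB (x y : Cplx R) : complex.Re (x - y) = complex.Re x - complex.Re y.
  by case: x; case: y.
under eq_fun do rewrite mulrBr ReB.
rewrite mulrBr ReB -(deriv_exp_taylor R n).
apply: is_deriveB; [exact: is_derive_Re_expC|exact: is_derive_Re_horner].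
Qed.

(** The remainder of order n + 1 has the remainder of order n as derivative
    and vanishes at 0, so the mean value theorem gives one more factor [h] at
    each step of an induction on [n], for all weights [c] at once. *)
Lemma Re_taylor_bound (R : realType) n (c h : Cplx R) (t : R) :
  modulus h <= 1 -> 0 <= t <= 1 ->
  `|complex.Re (c * (expC (ofR t * h) - (exp_taylor R n).[ofR t * h]))|
    <= expR 1 * modulus c * modulus h ^+ n.
Proof.
move=> h1; elim: n c t => [|n ih] c t /andP[t0 t1].
  rewrite /exp_taylor poly_def big_ord0 horner0 subr0 expr0 mulr1.
  apply: le_trans (Re_le_modulus _) _; rewrite modulusM mulrC.
  rewrite ler_wpM2r ?modulus_ge0// modulus_expC ler_expR.
  apply: le_trans (ler_norm _) _; apply: le_trans (Re_le_modulus _) _.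
  by rewrite modulusM modulus_ofR ger0_norm// mulr_ile1// modulus_ge0.
have F0 : complex.Re
    (c * (expC (ofR 0 * h) - (exp_taylor R n.+1).[ofR 0 * h])) = 0.
  rewrite [ofR 0 * h]mul0r expC0 horner_coef0 coef_poly /= fact0 invr1.
  by rewrite subrr mulr0.
have [->|tn0] := eqVneq t 0.
  by rewrite F0 normr0 !mulr_ge0 ?exprn_ge0 ?modulus_ge0 ?expR_ge0.
have {tn0} tgt0 : 0 < t by rewrite lt_def tn0.
have [|s] := MVT tgt0 (fun s _ => is_derive_Re_taylor n c h s).
  apply: continuous_subspaceT => x.
  apply/differentiable_continuous/derivable1_diffP.
  exact: (@ex_derive _ _ _ _ _ _ _ (is_derive_Re_taylor n c h x)).
rewrite in_itv /= => /andP[s0 st].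
rewrite F0 subr0 => ->; rewrite subr0 normrM (ger0_norm t0).
apply: le_trans (_ : expR 1 * modulus (c * h) * modulus h ^+ n * 1 <= _).
  apply: ler_pM => //; apply: ih; rewrite (ltW s0)/=.
  exact: le_trans (ltW st) t1.
by rewrite mulr1 modulusM exprS !mulrA.
Qed.

(** The choice of the conjugate of the remainder as weight [c] turns the bound
    on real parts into a bound on the modulus. *)
Lemma taylor_bound (R : realType) n (h : Cplx R) :
  modulus h <= 1 ->
  modulus (expC h - (exp_taylor R n).[h]) <= expR 1 * modulus h ^+ n.
Proof.
move=> h1; set F := _ - _.
have [F0|F0] := eqVneq F 0.
  by rewrite F0 modulus0 mulr_ge0 ?exprn_ge0 ?modulus_ge0 ?expR_ge0.
have := Re_taylor_bound n (conjc F : Cplx R) h1 (t := 1).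
rewrite [ofR 1 * h]mul1r ler01 lexx => /(_ isT); rewrite -/F.
have -> : complex.Re ((conjc F : Cplx R) * F) = modulus F ^+ 2.
  by rewrite sqr_modulus; case: (F) => a b /=; ring.
have -> : modulus (conjc F : Cplx R) = modulus F by rewrite /modulus normcJ.
rewrite ger0_norm ?exprn_ge0 ?modulus_ge0// expr2 mulrAC.
by rewrite ler_pM2r // modulus_gt0.
Qed.

(** * Complex derivatives *)

Lemma is_derive_of_quadratic_bound (R : realType) (f : Cplx R -> Cplx R)
    (z l : Cplx R) (K : R) :
  (forall h, modulus h <= 1 ->
     modulus (f (h + z) - f z - l * h) <= K * modulus h ^+ 2) ->
  is_derive z 1 f l.
Proof.
move=> fK.
have cvl :
    h^-1 *: ((f \o shift z) (h *: (1 : Cplx R)) - f z) @[h --> 0^'] --> l.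
  apply/cvgrPdist_lt => e e0.
  have eR : ofR (complex.Re e) = e by apply/RRe_real/gtr0_real.
  have {}e0 : 0 < complex.Re e by rewrite -ofR_lt eR.
  apply/nbhs_modulusP; exists (Num.min 1 (complex.Re e / (`|K| + 1))).
    by rewrite lt_min ltr01 divr_gt0// ltr_pwDr.
  move=> h; rewrite subr0 lt_min => /andP[h1 he] h0.
  rewrite -eR -modulusE ofR_lt /= modulusC.
  have -> : h^-1 *: (f (h *: (1 : Cplx R) + z) - f z) - l =
      h^-1 * (f (h + z) - f z - l * h).
    rewrite /GRing.scale /= mulr1; field.
    exact: h0.
  have hg0 : 0 < modulus h by rewrite modulus_gt0; exact: h0.
  rewrite modulusM modulusV ltr_pdivrMl//.
  apply: le_lt_trans (fK _ (ltW h1)) _.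
  move: he; rewrite ltr_pdivlMr ?ltr_pwDr// => he.
  rewrite expr2 mulrCA ltr_pM2l//.
  apply: le_lt_trans he; rewrite mulrC ler_wpM2l ?modulus_ge0//.
  by apply: le_trans (ler_norm K) _; rewrite lerDl.
by apply: DeriveDef; [exact: cvgP cvl|exact: cvg_lim cvl].
Qed.

Lemma exp_taylor2 (R : realType) (h : Cplx R) : (exp_taylor R 2).[h] = 1 + h.
Proof.
rewrite /exp_taylor poly_def !big_ord_recl big_ord0 /= !hornerE /=.
by rewrite ?invr1; ring.
Qed.

Lemma is_derive_expC (R : realType) (z : Cplx R) :
  is_derive z 1 (@expC R) (expC z).
Proof.
apply: (@is_derive_of_quadratic_bound _ _ _ _ (modulus (expC z) * expR 1)).
move=> h h1; rewrite expCD.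
have -> : expC h * expC z - expC z - expC z * h =
    expC z * (expC h - (exp_taylor R 2).[h]).
  by rewrite exp_taylor2; ring.
by rewrite modulusM -mulrA ler_wpM2l ?modulus_ge0//; exact: taylor_bound.
Qed.

Lemma is_derive_horner (R : realType) (p : {poly Cplx R}) (z : Cplx R) :
  is_derive z 1 (horner p) p^`().[z].
Proof.
elim/poly_ind: p => [|p a ih].
  rewrite (_ : horner 0 = cst 0); last by apply/funext => x; rewrite horner0.
  by rewrite deriv0 horner0; exact: is_derive_cst.
rewrite (_ : horner _ = horner p * id + cst a); last first.
  by apply/funext => x; rewrite !hornerE.
have d1 := is_deriveM ih (is_derive_id z (1 : Cplx R)).
apply: (is_derive_eq (is_deriveD d1 (is_derive_cst a z _))).
rewrite derivD derivM derivX derivC !addr0 mulr1 hornerD hornerMX.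
by rewrite /GRing.scale /= mulr1 addrC mulrC.
Qed.

(** * Local behaviour of exponential polynomials *)

Lemma horner_bounded (R : realType) (p : {poly Cplx R}) :
  exists2 K : R, 0 <= K & forall h, modulus h <= 1 -> modulus p.[h] <= K.
Proof.
elim/poly_ind: p => [|p a [K K0 pK]].
  by exists 0 => // h _; rewrite horner0 modulus0.
exists (K + modulus a) => [|h h1]; first by rewrite addr_ge0 ?modulus_ge0.
rewrite !hornerE; apply: le_trans (modulusD _ _) _; rewrite lerD2r modulusM.
by rewrite -[K]mulr1 ler_pM ?modulus_ge0 ?pK.
Qed.

(** Replace e^h by a Taylor polynomial of degree size Q + 1, at a cost of
    O(h^(size Q + 2)). The result is a polynomial in [h] which is not constant,
    because Q (h + z) has no term of degree size Q + 1; factoring the highest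
    power of [h] out of its increment gives [n] and [c]. *)
Lemma local_expansion (R : realType) (Q : {poly Cplx R}) (z : Cplx R) :
  exists n (c : Cplx R) (K : R), [/\ (0 < n)%N, c != 0, 0 <= K &
    forall h, modulus h <= 1 ->
      modulus (exp_plus_poly Q (h + z) - exp_plus_poly Q z - c * h ^+ n)
        <= K * modulus h ^+ n.+1].
Proof.
pose N := (size Q).+2.
pose T := expC z *: exp_taylor R N + (Q \Po ('X + z%:P)).
have T0 : T.[0] = exp_plus_poly Q z.
  rewrite /T hornerD hornerZ horner_comp !hornerE /exp_plus_poly.
  by rewrite horner_coef0 coef_poly /= fact0 invr1 mulr1.
have szQ : (size (Q \Po ('X + z%:P)) <= size Q)%N.
  by rewrite size_comp_poly2 ?size_XaddC.
pose T1 := T - T.[0]%:P.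
have szT1 : (size T1 <= N)%N.
  apply: leq_trans (size_polyD _ _) _; rewrite geq_max size_polyN.
  rewrite (leq_trans (size_polyC_leq1 _))// andbT.
  apply: leq_trans (size_polyD _ _) _; rewrite geq_max.
  rewrite (leq_trans (size_scale_leq _ _)) ?size_poly//=.
  by rewrite (leq_trans szQ)// /N ltnW.
have T1n0 : T1 != 0.
  apply/eqP => /(congr1 (fun p : {poly Cplx R} => p`_(size Q).+1)).
  rewrite coef0 coefB coefC /= subr0 coefD coefZ coef_poly ltnSn.
  rewrite (nth_default 0 (leq_trans szQ _))// addr0 => /eqP.
  rewrite mulf_eq0 (negbTE (expC_neq0 _)) /= invr_eq0 pnatr_eq0.
  by rewrite eqn0Ngt fact_gt0.
have T1r : T1.[0] = 0 by rewrite /T1 !hornerE subrr.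
have [n [U /implyP/(_ T1n0) rU T1E]] := multiplicity_XsubC T1 0.
rewrite subr0 in T1E.
have n0 : (0 < n)%N.
  rewrite lt0n; apply/eqP => n0; move: rU; rewrite rootE.
  by rewrite -[U]mulr1 -(expr0 'X) -n0 -T1E T1r eqxx.
have U0 : U != 0 by apply: contraNneq rU => ->; rewrite root0.
have nN : (n.+1 <= N)%N.
  apply: leq_trans szT1; rewrite T1E size_Mmonic ?monicXn// size_polyXn.
  by rewrite addnS /= -addn1 addnC leq_add2r lt0n size_poly_eq0.
have [V UV] : exists V, U - U.[0]%:P = V * ('X - 0%:P).
  by apply/factor_theorem; rewrite rootE !hornerE subrr.
have [K K0 VK] := horner_bounded V.
exists n, U.[0], (modulus (expC z) * expR 1 + K); split=> //.
  by rewrite addr_ge0// mulr_ge0 ?modulus_ge0 ?expR_ge0.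
move=> h h1.
have -> : exp_plus_poly Q (h + z) - exp_plus_poly Q z - U.[0] * h ^+ n =
    expC z * (expC h - (exp_taylor R N).[h]) + V.[h] * h ^+ n.+1.
  have -> : V.[h] * h ^+ n.+1 = T1.[h] - U.[0] * h ^+ n.
    rewrite T1E hornerM hornerXn -mulrBl exprS mulrA; congr (_ * _).
    have /(congr1 (fun p : {poly Cplx R} => p.[h])) := UV.
    by rewrite !hornerE subr0.
  have -> : T1.[h] = T.[h] - T.[0] by rewrite /T1 hornerD hornerN hornerC.
  have -> : T.[h] = expC z * (exp_taylor R N).[h] + Q.[h + z].
    by rewrite /T hornerD hornerZ horner_comp !hornerE.
  by rewrite T0 /exp_plus_poly expCD; ring.
apply: le_trans (modulusD _ _) _; rewrite mulrDl !modulusM modulusX.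
have hN : modulus h ^+ N <= modulus h ^+ n.+1.
  by rewrite ler_wiXn2l ?modulus_ge0.
apply: lerD; last by rewrite ler_wpM2r ?exprn_ge0 ?modulus_ge0 ?VK.
rewrite -mulrA ler_wpM2l ?modulus_ge0//.
apply: le_trans (taylor_bound _ h1) _.
by rewrite ler_wpM2l ?expR_ge0.
Qed.

Lemma locally_lipschitz (R : realType) (Q : {poly Cplx R}) (z : Cplx R) :
  exists2 L : R, 0 <= L & forall h, modulus h <= 1 ->
    modulus (exp_plus_poly Q (h + z) - exp_plus_poly Q z) <= L * modulus h.
Proof.
have [n [c [K [n0 c0 K0 cK]]]] := local_expansion Q z.
exists (K + modulus c) => [|h h1]; first by rewrite addr_ge0 ?modulus_ge0.
set d := exp_plus_poly Q (h + z) - exp_plus_poly Q z.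
rewrite -[d](subrK (c * h ^+ n)) (le_trans (modulusD _ _))// mulrDl.
have hn m : (0 < m)%N -> modulus h ^+ m <= modulus h.
  by move=> m0; rewrite -[leRHS]expr1 ler_wiXn2l ?modulus_ge0.
apply: lerD; first by rewrite (le_trans (cK _ h1))// ler_wpM2l// hn.
by rewrite modulusM modulusX ler_wpM2l ?modulus_ge0// hn.
Qed.

Lemma continuous_exp_plus_poly (R : realType) (Q : {poly Cplx R}) :
  continuous (exp_plus_poly Q).
Proof.
move=> z U /nbhs_modulusP[e e0 zU].
have [L L0 QL] := locally_lipschitz Q z.
apply/nbhs_modulusP; exists (Num.min 1 (e / (L + 1))).
  by rewrite lt_min ltr01 divr_gt0// ltr_wpDl.
move=> w; rewrite lt_min => /andP[w1 we]; apply: zU.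
rewrite -[w in exp_plus_poly _ w](subrK z).
apply: le_lt_trans (QL _ (ltW w1)) _.
move: we; rewrite ltr_pdivlMr ?ltr_wpDl// => we.
apply: le_lt_trans we; rewrite mulrC ler_wpM2l ?modulus_ge0//.
by rewrite lerDl.
Qed.

(** At a zero, the term c h^n of the local expansion dominates the error. *)
Lemma isolated_zeros (R : realType) (Q : {poly Cplx R}) (z : Cplx R) :
  \forall w \near z, w != z -> exp_plus_poly Q w != 0.
Proof.
have [gz|gz] := eqVneq (exp_plus_poly Q z) 0; last first.
  have zn0 : \forall w \near z, exp_plus_poly Q w != 0.
    apply: (@continuous_exp_plus_poly R Q z [set w | w != 0]).
    apply/nbhs_modulusP.
    exists (modulus (exp_plus_poly Q z)); first by rewrite modulus_gt0.
    by move=> w; apply: contraTneq => ->; rewrite sub0r modulusN ltxx.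
  by apply: filterS zn0 => w wn0 _.
have [n [c [K [n0 c0 K0 cK]]]] := local_expansion Q z.
apply/nbhs_modulusP; exists (Num.min 1 (modulus c / (K + 1))).
  by rewrite lt_min ltr01 divr_gt0 ?modulus_gt0// ltr_wpDl.
move=> w; rewrite lt_min => /andP[w1 wc] wz; apply/eqP => gw.
have := cK _ (ltW w1); rewrite subrK gw gz subr0 sub0r modulusN.
rewrite modulusM modulusX exprSr mulrA mulrAC.
have h0 : 0 < modulus (w - z) by rewrite modulus_gt0 subr_eq0.
rewrite ler_pM2r ?exprn_gt0// leNgt => /negP; apply.
move: wc; rewrite ltr_pdivlMr ?ltr_wpDl// mulrDr mulr1 mulrC.
by apply: le_lt_trans; rewrite lerDl ltW.
Qed.

(** The minimum modulus principle: moving in a direction [s] with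
    c s^n = - g z decreases |g|, as g (z + t s) is then (1 - t^n) g z up to
    O(t^(n+1)). *)
Lemma modulus_not_minimal (R : realType) (Q : {poly Cplx R}) (z : Cplx R) :
  exp_plus_poly Q z != 0 ->
  forall U, nbhs z U ->
  exists2 w, U w & modulus (exp_plus_poly Q w) < modulus (exp_plus_poly Q z).
Proof.
move=> gz U /nbhs_modulusP[e e0 zU].
have [n [c [K [n0 c0 K0 cK]]]] := local_expansion Q z.
set g := exp_plus_poly Q in gz cK *.
pose s := n.-root (- (g z / c)).
have cs : c * s ^+ n = - g z by rewrite rootCK// mulrN mulrC divfK.
have s0 : 0 < modulus s.
  rewrite modulus_gt0; apply: contra_eq_neq cs => ->.
  by rewrite expr0n gtn_eqF// mulr0 eq_sym oppr_eq0.
pose b := K * modulus s ^+ n.+1 + 1.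
have b0 : 0 < b by rewrite ltr_wpDl// mulr_ge0// exprn_ge0 ?modulus_ge0.
have gz0 : 0 < modulus (g z) by rewrite modulus_gt0.
(* The bounds on [t] ensure, in this order: 1 - t^n >= 0, |h| <= 1 so that the
   expansion applies, h + z in [U], and an error below t^n |g z|. *)
pose t := Num.min (Num.min 1 (2^-1 / modulus s))
   (Num.min (e / (2 * modulus s)) (2^-1 * (modulus (g z) / b))).
have t0 : 0 < t by rewrite !lt_min ltr01 !divr_gt0 ?mulr_gt0 ?invr_gt0 ?ltr0n.
have [t1 ts te tb] : [/\ t <= 1, t * modulus s <= 1, t * modulus s < e &
    t * b < modulus (g z)].
  have /andP[/andP[t1 ts] /andP[te tb]] : (t <= 1) && (t <= 2^-1 / modulus s) &&
    ((t <= e / (2 * modulus s)) && (t <= 2^-1 * (modulus (g z) / b))).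
    by rewrite -!le_min.
  split=> //.
  - by move: ts; rewrite ler_pdivlMr//; lra.
  - by move: te; rewrite ler_pdivlMr ?mulr_gt0//; lra.
  - by move: tb; rewrite mulrA ler_pdivlMr//; lra.
pose h := ofR t * s.
have hE : modulus h = t * modulus s by rewrite modulusM modulus_ofR gtr0_norm.
have h1 : modulus h <= 1 by rewrite hE.
exists (h + z); first by apply: zU; rewrite addrK hE.
have -> : g (h + z) = (g (h + z) - g z - c * h ^+ n) + ofR (1 - t ^+ n) * g z.
  have -> : c * h ^+ n = - (ofR (t ^+ n) * g z).
    rewrite /h exprMn mulrCA cs mulrN; congr (- (_ * _)).
    by rewrite /ofR rmorphXn.
  by rewrite -[1 - _]/(1 + - _) ofRD /ofR rmorphN rmorph1; ring.
apply: le_lt_trans (modulusD _ _) _; rewrite modulusM modulus_ofR.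
rewrite ger0_norm; last by rewrite subr_ge0 exprn_ile1// ltW.
rewrite mulrBl mul1r addrCA gtrDl subr_lt0.
apply: le_lt_trans (cK _ h1) _; rewrite hE exprMn exprSr mulrCA -!mulrA.
rewrite ltr_pM2l ?exprn_gt0//; apply: le_lt_trans tb.
by rewrite ler_pM2l// lerDl.
Qed.

(** * Discs *)

Lemma modulus_le_ReIm (R : realType) (z : Cplx R) :
  modulus z <= `|complex.Re z| + `|complex.Im z|.
Proof.
rewrite -(@ler_pXn2r _ 2)// ?nnegrE ?modulus_ge0 ?addr_ge0// sqr_modulus.
rewrite sqrrD !real_normK ?num_real// lerD2r lerDl.
by rewrite mulrn_wge0// mulr_ge0.
Qed.

Lemma Im_le_modulus (R : realType) (z : Cplx R) :
  `|complex.Im z| <= modulus z.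
Proof.
rewrite -(@ler_pXn2r _ 2)// ?nnegrE ?modulus_ge0// sqr_modulus.
by rewrite real_normK ?num_real// lerDr sqr_ge0.
Qed.

Definition disc (R : realType) (z : Cplx R) (r : R) : set (Cplx R) :=
  [set w | modulus (w - z) <= r].

Lemma continuous_Complex (R : realType) :
  continuous (fun p : R * R => (p.1 +i* p.2)%C : Cplx R).
Proof.
move=> [x y] U /nbhs_modulusP[e e0 xyU].
exists (ball x (e / 2), ball y (e / 2)).
  by split; apply: nbhsx_ballx; rewrite divr_gt0.
move=> [a b] [/=]; rewrite -!ball_normE /= => ax by_; apply: xyU.
apply: le_lt_trans (modulus_le_ReIm _) _ => /=.
by rewrite [e]splitr distrC [`|b - y|]distrC ltrD.
Qed.

Lemma continuous_modulus (R : realType) : continuous (@modulus R).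
Proof.
move=> z U /nbhs_ballP[e /= e0 zU]; apply/nbhs_modulusP; exists e => // w wz.
apply: zU; rewrite -ball_normE /=; apply: le_lt_trans wz.
rewrite ler_norml modulusC modulusB andbT lerNl opprB.
by apply: le_trans (modulusB _ _) _; rewrite modulusC.
Qed.

Lemma closed_disc (R : realType) (z : Cplx R) (r : R) : closed (disc z r).
Proof.
apply: (@preimage_closed _ _ (fun w => modulus (w - z)) [set x | x <= r]);
  last exact: closed_le.
move=> w _.
apply: (@continuous_comp _ _ _ (fun w : Cplx R => w - z) (@modulus R)).
  by apply: (@continuousB _ _ _ id (cst z) w);
    [exact: cvg_id|exact: cst_continuous].
exact: continuous_modulus.
Qed.

Lemma compact_disc (R : realType) (z : Cplx R) (r : R) : compact (disc z r).
Proof.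
have bc := compact_setX
  (@segment_compact R (complex.Re z - r) (complex.Re z + r))
  (@segment_compact R (complex.Im z - r) (complex.Im z + r)).
have := continuous_compact (continuous_subspaceT (@continuous_Complex R)) bc.
move=> /(subclosed_compact (@closed_disc R z r)); apply.
move=> w wz; exists (complex.Re w, complex.Im w); last by case: w {wz}.
rewrite /= !in_itv /= -!ler_distl.
have := Re_le_modulus (w - z); have := Im_le_modulus (w - z).
move: wz; rewrite /disc /=; case: w => a b; case: z {bc} => c d /= wz ? ?.
by split; apply: le_trans wz.
Qed.

(** Each point has a neighbourhood that contains no other zero, and
    finitely many of them cover the disc. *)
Lemma finite_zeros_in_disc (R : realType) (Q : {poly Cplx R}) (r : R) :
  finite_set [set z | modulus z <= r /\ exp_plus_poly Q z = 0].
Proof.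
have := @compact_disc R 0 r; rewrite compact_cover.
pose f (z : Cplx R) := [set w | w != z -> exp_plus_poly Q w != 0]°.
move=> /(_ _ setT f) [].
- by move=> z _; exact: open_interior.
- by move=> z _; exists z => //; exact: isolated_zeros.
move=> D _ Df; apply: sub_finite_set (finite_fset D) => z [zr gz].
have [|w wD /interior_subset zw] := Df z; first by rewrite /disc /= subr0.
have [->|zw'] := eqVneq z w; first exact: wD.
by have := zw zw'; rewrite gz eqxx.
Qed.

(** * Growth of polynomials *)

Lemma horner_unbounded (R : realType) (p : {poly Cplx R}) (M : R) :
  (1 < size p)%N -> exists r, forall z, r <= modulus z -> M <= modulus p.[z].
Proof.
elim/poly_ind: p M => [|p a ih] M; first by rewrite size_poly0.
have [p1|p1 _] := leqP (size p) 1; last first.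
  have [r rp] := ih 1 p1; exists (Num.max r (M + modulus a)) => z.
  rewrite ge_max => /andP[rz Mz]; rewrite !hornerE -[a]opprK.
  apply: le_trans (modulusB _ _); rewrite modulusN lerBrDr modulusM.
  apply: le_trans Mz _; rewrite -[leLHS]mul1r ler_wpM2r ?modulus_ge0//.
  exact: rp.
rewrite [p]size1_polyC//; set b := p`_0.
have [->|b0 _] := eqVneq b 0.
  by rewrite mul0r add0r size_polyC; case: (_ != _).
exists ((M + modulus a) / modulus b) => z.
rewrite ler_pdivrMr ?modulus_gt0// => Mz; rewrite !hornerE -[a]opprK.
apply: le_trans (modulusB _ _); rewrite modulusN lerBrDr modulusM.
by rewrite mulrC.
Qed.

(** Estimates that are stable under products need only be checked on linear
    factors. *)
Lemma poly_factor_ind (F : closedFieldType) (K : {poly F} -> Prop) :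
  (forall c, c != 0 -> K c%:P) ->
  (forall a p, p != 0 -> K p -> K (('X - a%:P) * p)) ->
  forall p, p != 0 -> K p.
Proof.
move=> Kc KX p p0; have [s ->] := closed_field_poly_normal p.
have c0 : lead_coef p != 0 by rewrite lead_coef_eq0.
elim: s => [|a s ih]; first by rewrite big_nil alg_polyC; exact: Kc.
rewrite big_cons scalerAr; apply: KX => //.
rewrite scaler_eq0 negb_or c0 /=.
by apply: monic_neq0; exact: monic_prod_XsubC.
Qed.

Lemma linear_factor_far (R : realType) (a z : Cplx R) :
  2 * modulus a <= modulus z ->
  modulus z / 2 <= modulus (z - a) <= 2 * modulus z.
Proof.
move=> az; have := modulusB z a; have := modulusD z (- a).
by rewrite modulusN; have := modulus_ge0 a; lra.
Qed.

(** A displacement of [a] which is small compared to |a| changes Q(a) little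
    compared to |Q(a)|: it moves each linear factor by a small proportion. *)
Lemma slow_variation (R : realType) (Q : {poly Cplx R}) : Q != 0 ->
  forall e : R, 0 < e -> exists2 d : R, 0 < d & exists M : R, forall a u,
    M <= modulus a -> modulus u <= d * modulus a ->
    modulus (Q.[a + u] - Q.[a]) <= e * modulus Q.[a].
Proof.
move: Q; apply: poly_factor_ind => [c c0|b q q0 ih] e e0.
  exists 1 => //; exists 0 => a u _ _; rewrite !hornerC subrr modulus0.
  by rewrite mulr_ge0 ?modulus_ge0 ?ltW.
have e'0 : 0 < Num.min 1 (e / 2) by rewrite lt_min ltr01 divr_gt0.
have [d d0 [M dM]] := ih _ e'0.
exists (Num.min d (e / 8)); first by rewrite lt_min d0 divr_gt0.
exists (Num.max M (2 * modulus b)) => a u.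
rewrite ge_max => /andP[Ma ba].
rewrite minr_pMl ?modulus_ge0// le_min => /andP[ud ue].
have [ab _] := andP (linear_factor_far ba).
have := dM a u Ma ud; rewrite minr_pMl ?modulus_ge0// le_min mul1r.
move=> /andP[qa1 qae].
have qau : modulus q.[a + u] <= 2 * modulus q.[a].
  by have := modulusB q.[a + u] q.[a]; lra.
rewrite !hornerM !hornerXsubC.
have -> : (a + u - b) * q.[a + u] - (a - b) * q.[a] =
    (a - b) * (q.[a + u] - q.[a]) + u * q.[a + u] by ring.
apply: le_trans (modulusD _ _) _; rewrite !modulusM.
have -> : e * (modulus (a - b) * modulus q.[a]) =
    modulus (a - b) * (e / 2 * modulus q.[a]) +
    (e / 4 * modulus (a - b)) * (2 * modulus q.[a]) by field.
apply: lerD; first by rewrite ler_wpM2l ?modulus_ge0.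
by apply: ler_pM; rewrite ?modulus_ge0//; nra.
Qed.

Lemma ln_le_linear (R : realType) (e x : R) : 0 < e -> 0 < x ->
  ln x <= e * x - ln e.
Proof.
move=> e0 x0; rewrite lerBrDl -lnM ?posrE//.
by apply: ltW; apply: ln_sublinear; rewrite mulr_gt0.
Qed.

(** log |Q(a)| = o(|a|), again because it holds for each linear factor. *)
Lemma ln_horner_sublinear (R : realType) (Q : {poly Cplx R}) : Q != 0 ->
  forall e : R, 0 < e -> exists M : R, forall a, M <= modulus a ->
    Q.[a] != 0 /\ `|ln (modulus Q.[a])| <= e * modulus a.
Proof.
move: Q; apply: poly_factor_ind => [c c0|b q q0 ih] e e0.
  exists (`|ln (modulus c)| / e) => a; rewrite ler_pdivrMr// => ca.
  by rewrite hornerC; split; rewrite // mulrC.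
have [|M qM] := ih (e / 2); first by rewrite divr_gt0.
pose C := `|ln (e / 8)|.
exists (Num.max (Num.max M (2 * modulus b)) (Num.max 2 (C / (e / 4)))) => a.
rewrite !ge_max => /andP[/andP[Ma ba] /andP[a2]].
rewrite ler_pdivrMr ?divr_gt0// => Ca.
have [qa lnqa] := qM a Ma.
have /andP[ab1 ab2] := linear_factor_far ba.
have ab0 : 0 < modulus (a - b) by lra.
rewrite hornerM hornerXsubC modulusM; split.
  by rewrite mulf_neq0// -modulus_gt0.
rewrite lnM ?posrE ?modulus_gt0//; last by rewrite -modulus_gt0.
apply: le_trans (ler_normD _ _) _; rewrite [leRHS](_ : _ =
  e / 2 * modulus a + e / 2 * modulus a); last by field.
apply: lerD => //; rewrite ger0_norm; last by apply: ln_ge0; lra.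
have e8 : 0 < e / 8 by rewrite divr_gt0.
apply: le_trans (ln_le_linear e8 ab0) _.
have : - ln (e / 8) <= C by rewrite /C -normrN ler_norm.
by nra.
Qed.

(** * Far zeros of exponential polynomials *)

(** The bound on [w] comes from the choice of the argument in [-pi, pi]. *)
Lemma expC_surj (R : realType) (v : Cplx R) : v != 0 ->
  exists2 w, expC w = v & modulus w <= `|ln (modulus v)| + pi.
Proof.
move=> v0; have vg0 : 0 < modulus v by rewrite modulus_gt0.
pose x := complex.Re v / modulus v; pose y := complex.Im v / modulus v.
have xy1 : x ^+ 2 + y ^+ 2 = 1.
  rewrite /x /y !exprMn -mulrDl -sqr_modulus exprVn divff//.
  by rewrite expf_neq0// gt_eqF.
have x1 : -1 <= x <= 1.
  rewrite -ler_norml -(@ler_pXn2r _ 2)// ?nnegrE// real_normK ?num_real//.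
  by rewrite expr1n -xy1 lerDl sqr_ge0.
have [t [ct st tpi]] : exists t, [/\ cos t = x, sin t = y & `|t| <= pi].
  have cx : cos (acos x) = x by apply: acosK; rewrite in_itv.
  have sx : sin (acos x) = `|y|.
    by rewrite sin_acos// -xy1 addrC addKr sqrtr_sqr.
  have ax : `|acos x| <= pi by rewrite ger0_norm ?acos_ge0// acos_lepi.
  have [y0|y0] := leP 0 y.
    by exists (acos x); rewrite cx sx ger0_norm.
  by exists (- acos x); rewrite cosN sinN cx sx ltr0_norm// opprK normrN.
exists (ln (modulus v) +i* t)%C.
  rewrite /expC /= lnK ?posrE// ct st /x /y.
  rewrite !(mulrC (modulus v)) !divfK ?gt_eqF//.
  by case: (v).
by apply: le_trans (modulus_le_ReIm _) _; rewrite /= lerD2l.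
Qed.

Lemma expC_period (R : realType) (k : nat) :
  expC (0 +i* (pi *+ 2 *+ k))%C = 1 :> Cplx R.
Proof.
rewrite /expC /= expR0 !mul1r -[_ *+ k]add0r.
by rewrite (periodicn (@cosD2pi R)) (periodicn (@sinD2pi R)) cos0 sin0.
Qed.

Lemma expC_sub1_lower (R : realType) (h : Cplx R) : modulus h <= 1 ->
  modulus h - expR 1 * modulus h ^+ 2 <= modulus (1 - expC h).
Proof.
move=> h1; have := taylor_bound 2 h1; rewrite exp_taylor2.
have := modulusB h (- (expC h - (1 + h))).
have -> : h - - (expC h - (1 + h)) = - (1 - expC h) by ring.
rewrite !modulusN; lra.
Qed.

(** The minimum of |g| over the disc is at most its value at the centre, hence
    is not on the circle; inside, it must be a zero. *)
Lemma exp_plus_poly_zero_of_boundary (R : realType) (Q : {poly Cplx R})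
    (w : Cplx R) (r : R) : 0 <= r ->
  (forall z, modulus (z - w) = r ->
    modulus (exp_plus_poly Q w) < modulus (exp_plus_poly Q z)) ->
  exists2 z, disc w r z & exp_plus_poly Q z = 0.
Proof.
move=> r0 bd; pose F z := modulus (exp_plus_poly Q z).
have Fc : continuous F.
  move=> z; apply: (@continuous_comp _ _ _ (exp_plus_poly Q) (@modulus R)).
    exact: continuous_exp_plus_poly.
  exact: continuous_modulus.
have ww : disc w r w by rewrite /disc /= subrr modulus0.
have [|c cD cmin] := compact_EVT_min _ (@compact_disc R w r)
    (continuous_subspaceT Fc); first by exists w.
have {}cmin z : disc w r z -> F c <= F z by move=> wz; apply: cmin; rewrite inE.
move: cD; rewrite inE => cD; exists c => //; apply/eqP/negPn/negP => gc.
move: (cD); rewrite /disc /= le_eqVlt => /predU1P[cr|cr].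
  by have := lt_le_trans (bd _ cr) (cmin _ ww); rewrite ltxx.
have cw : nbhs c (disc w r).
  apply/nbhs_modulusP; exists (r - modulus (c - w)); first by rewrite subr_gt0.
  move=> z zc; rewrite /disc /= -[z - w](subrKA c).
  by apply: le_trans (modulusD _ _) _; rewrite -lerBrDr ltW.
have [z wz] := modulus_not_minimal gc cw.
by rewrite ltNge => /negP; apply; exact: cmin.
Qed.

(** Here e^(h + w0 + a) = - Q(a) e^h for all [h], and Q (a + u) stays within
    |Q(a)| / (16 e) of Q(a) for all relevant [u]. On the circle |h| = 1 / (2 e)
    one has |1 - e^h| >= |h| - e |h|^2 = 1 / (4 e), which exceeds twice
    the error. *)
Lemma far_zeros (R : realType) (Q : {poly Cplx R}) (r : R) : Q != 0 ->
  exists2 z, r <= modulus z & exp_plus_poly Q z = 0.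
Proof.
move=> Q0; pose e : R := expR 1.
have e2 : 2 <= e by apply: le_trans (expR_ge1Dx 1); lra.
have e0 : 0 < e by lra.
have eps0 : 0 < (16 * e)^-1 by rewrite invr_gt0; lra.
have [d1 d10 [M1 M1P]] := slow_variation Q0 eps0.
(* The bound 1/2 keeps the zero to be found at distance at least |a| / 2 from 0. *)
pose d := Num.min d1 2^-1.
have d0 : 0 < d by rewrite lt_min d10 invr_gt0 ltr0n.
have dd1 : d <= d1 by rewrite ge_min lexx.
have d2 : d <= 2^-1 by rewrite ge_min lexx orbT.
have [|M2 M2P] := ln_horner_sublinear Q0 (e := d / 2); first by lra.
pose M := Num.max (Num.max M1 M2) (Num.max (2 * r) ((pi + 1) / (d / 2))).
pose k := Num.bound `|M|.
pose a : Cplx R := (0 +i* (pi *+ 2 *+ k))%C.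
have Ma : M <= modulus a.
  apply: le_trans (Im_le_modulus _) => /=; apply: le_trans (ler_norm _).
  apply: le_trans (ler_norm M) _;
  apply: le_trans (ltW (archi_boundP _)) _ => //.
  rewrite -/k -[leRHS]mulr_natr -[leLHS]mul1r ler_wpM2r ?ler0n// mulr2n.
  by have := @pi_ge2 R; lra.
move: Ma; rewrite !ge_max => /andP[/andP[M1a M2a] /andP[ra pia]].
have {}pia : pi + 1 <= modulus a * (d / 2) by rewrite -ler_pdivrMr//; lra.
have [Qa lnQa] := M2P _ M2a.
have qa0 : 0 < modulus Q.[a] by rewrite modulus_gt0.
have [|w0 w0E w0le] := @expC_surj R (- Q.[a]); first by rewrite oppr_eq0.
rewrite modulusN in w0le.
have gE h : exp_plus_poly Q (h + (w0 + a)) =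
    Q.[a] * (1 - expC h) + (Q.[a + (h + w0)] - Q.[a]).
  rewrite /exp_plus_poly !expCD w0E expC_period addrA [a + _]addrC; ring.
(* The radius that maximizes rho - e rho^2. *)
pose rho : R := (2 * e)^-1.
have rho0 : 0 < rho by rewrite invr_gt0; lra.
have rhoe : rho * e = 2^-1 by rewrite /rho; field; lra.
have rho1 : rho <= 1 by nra.
have uB h : modulus h <= rho -> modulus (h + w0) <= d * modulus a.
  by move=> hr; have := modulusD h w0; lra.
have QB h : modulus h <= rho ->
    modulus (Q.[a + (h + w0)] - Q.[a]) <= rho / 8 * modulus Q.[a].
  move=> hr; have -> : rho / 8 = (16 * e)^-1 by rewrite /rho; field; lra.
  apply: M1P => //; apply: le_trans (uB h hr) _.
  by rewrite ler_wpM2r ?modulus_ge0.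
have [z zr|z] := @exp_plus_poly_zero_of_boundary R Q (w0 + a) rho (ltW rho0).
  have -> : exp_plus_poly Q (w0 + a) = Q.[a + (0 + w0)] - Q.[a].
    by rewrite -[w0 + a]add0r gE expC0 subrr mulr0 !add0r.
  have := QB 0; rewrite modulus0 => /(_ (ltW rho0)) /le_lt_trans; apply.
  rewrite -[z](subrK (w0 + a)) gE; set h := z - _ in zr *.
  have h1 : modulus h <= 1 by rewrite zr.
  have := expC_sub1_lower h1; rewrite zr -/e => hE.
  have := QB h; rewrite zr lexx => /(_ isT) Qh.
  set X := Q.[a + (h + w0)] - Q.[a] in Qh *.
  have := modulusB (Q.[a] * (1 - expC h)) (- X).
  rewrite opprK modulusN modulusM.
  have rho2 : e * rho ^+ 2 = rho / 2 by rewrite -rhoe; ring.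
  have {}hE : rho / 2 <= modulus (1 - expC h) by move: hE; rewrite rho2; lra.
  have := ler_wpM2l (ltW qa0) hE; have := mulr_gt0 rho0 qa0; lra.
rewrite /disc /= => zr gz; exists z => //.
have := uB _ zr; have : d * modulus a <= 2^-1 * modulus a.
  by rewrite ler_wpM2r ?modulus_ge0.
have := modulusB a (- (z - (w0 + a) + w0)).
have -> : a - - (z - (w0 + a) + w0) = z by ring.
by rewrite modulusN; lra.
Qed.

(** * Limit points in the sphere *)

Lemma near_notin_finite (R : realType) (F : set (Cplx R)) (w : Cplx R) :
  finite_set F -> \forall x \near w, F x -> x = w.
Proof.
move=> finF; have : nbhs w (~` (F `\ w)).
  apply: open_nbhs_nbhs; split; last by case=> _; exact.
  apply: closed_openC; move: (F `\ w) (finite_setD [set w] finF).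
  apply/accessible_finite_set_closed/hausdorff_accessible.
  exact: norm_hausdorff.
apply: filterS => x nFx Fx; apply: contrapT => xw; exact: nFx.
Qed.

Lemma compact_modulus_bounded (R : realType) (K : set (Cplx R)) :
  compact K -> exists M, forall z, K z -> modulus z <= M.
Proof.
move=> cK; have [->|K0] := eqVneq K set0; first by exists 0.
have [|c _ cmax] := compact_EVT_max _ cK
  (continuous_subspaceT (@continuous_modulus R)); first exact/set0P.
by exists (modulus c) => z Kz; apply: cmax; rewrite inE.
Qed.

Lemma limit_point_infty (R : realType) (V : set (Cplx R)) :
  (forall M, finite_set [set v | V v /\ modulus v <= M]) ->
  (forall M, exists2 v, V v & M < modulus v) ->
  limit_point (@fin_pt R @` V) = [set infty_pt R].
Proof.
move=> finV unbV; apply/seteqP; split => [[w|]|_ ->]; last first.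
- move=> U [K [cK _] KU]; have [M KM] := compact_modulus_bounded cK.
  have [v Vv Mv] := unbV M.
  exists (fin_pt v); split; [exact/eqP|by exists v|].
  by apply: KU; left; exists v => // /KM; rewrite leNgt Mv.
- by move=> _.
move=> wlim; exfalso.
have [] := wlim (@fin_pt R @` [set x | modulus (x - w) < 1 /\
    (V x /\ modulus x <= modulus w + 1 -> x = w)]).
  apply: one_point_compactification_some_nbhs; apply: filterI.
    by apply/nbhs_modulusP; exists 1.
  exact: near_notin_finite (finV _).
move=> y [+ [v Vv vy] [x [xw xF] xy]]; rewrite -xy => /eqP; apply.
have xv : x = v by apply: Some_inj; rewrite [LHS]xy.
congr Some; apply: xF; rewrite xv in xw *; split => //.
by have := modulusB v w; lra.
Qed.

(** The map v |-> 1 / v + a carries finiteness in discs from [V] to [S] away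
    from [a]. As [V] does not accumulate at 0, the numbers 1 / v are bounded;
    so infinity, whether or not it belongs to [S], is not a limit point. *)
Lemma limit_point_recip (R : realType) (V : set (Cplx R)) (a : Cplx R)
    (S : set (sphere R)) :
  (forall M, finite_set [set v | V v /\ modulus v <= M]) ->
  (forall M, exists2 v, V v & M < modulus v) ->
  (forall v, V v -> v != 0 -> S (fin_pt (v^-1 + a))) ->
  (forall s, S s -> s <> infty_pt R ->
     exists v, [/\ V v, v != 0 & s = fin_pt (v^-1 + a)]) ->
  limit_point S = [set fin_pt a].
Proof.
move=> finV unbV VS SV; apply/seteqP; split => [[w|]|_ ->].
- move=> wlim; have [->//|wa] := eqVneq w a; exfalso.
  pose r := modulus (w - a).
  have r0 : 0 < r by rewrite modulus_gt0 subr_eq0.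
  pose F := (fun v => v^-1 + a) @` [set v | V v /\ modulus v <= 2 / r].
  have finF : finite_set F by apply: finite_image; exact: finV.
  have [] := wlim (@fin_pt R @` [set x | modulus (x - w) < r / 2 /\
    (F x -> x = w)]).
    apply: one_point_compactification_some_nbhs; apply: filterI.
      by apply/nbhs_modulusP; exists (r / 2) => //; rewrite divr_gt0.
    exact: near_notin_finite finF.
  move=> y [+ Sy [x [xw xF] xy]]; rewrite -xy in Sy * => /eqP; apply.
  have [|v [Vv v0 [xv]]] := SV _ Sy; first by [].
  congr Some; apply: xF; exists v => //; split => //.
  have vg0 : 0 < modulus v by rewrite modulus_gt0.
  have : r / 2 <= modulus v^-1.
    have -> : v^-1 = (w - a) - (w - x) by rewrite xv; ring.
    apply: le_trans (modulusB _ _); rewrite -/r modulusC; lra.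
  rewrite modulusV -[r / 2]invrK lef_pV2 ?posrE ?invr_gt0 ?divr_gt0//.
  by rewrite invf_div.
- move=> infl; exfalso.
  have : \forall x \near (0 : Cplx R), V x /\ modulus x <= 1 -> x = 0.
    exact: near_notin_finite (finV _).
  move=> /nbhs_modulusP[e e0 V0].
  pose m := Num.max 1 e^-1.
  have [] := infl (@fin_pt R @` (~` disc 0 (m + modulus a)) `|` [set None]).
    exists (disc 0 (m + modulus a)) => //; split.
      exact: compact_disc.
    exact: closed_disc.
  move=> s [/eqP sinf Ss]; case; last by [].
  move=> [x xD xs]; have [v [Vv v0 sv]] := SV _ Ss sinf.
  move: sv; rewrite -xs => -[xv]; apply: xD.
  rewrite /disc /= subr0 xv; apply: le_trans (modulusD _ _) _.
  rewrite lerD2r modulusV; have vg0 : 0 < modulus v by rewrite modulus_gt0.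
  rewrite leNgt; apply/negP; rewrite gt_max => /andP[v1 ve].
  move/eqP: v0; apply; apply: V0.
    by rewrite subr0 -ltf_pV2 ?posrE.
  by split=> //; rewrite ltW// -ltf_pV2 ?posrE// invr1.
- move=> U aU; have /nbhs_modulusP[e e0 eU] : nbhs a (fun x => U (fin_pt x)).
    exact: aU.
  have [v Vv ve] := unbV e^-1.
  have vg0 : 0 < modulus v by apply: lt_trans ve; rewrite invr_gt0.
  have v0 : v != 0 by rewrite -modulus_gt0.
  exists (fin_pt (v^-1 + a)); split; last 1 first.
  - by apply: eU; rewrite addrK modulusV -[e]invrK ltf_pV2 ?posrE ?invr_gt0.
  - apply/eqP => -[] /eqP; rewrite -subr_eq0 addrK invr_eq0.
    by rewrite (negbTE v0).
  - exact: VS.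
Qed.

(** * Critical values *)

Lemma is_derive_exp_plus_poly (R : realType) (P : {poly Cplx R})
    (z : Cplx R) :
  is_derive z 1 (exp_plus_poly P) (exp_plus_poly P^`() z).
Proof. exact: is_deriveD (is_derive_expC z) (is_derive_horner P z). Qed.

Lemma critical_pointsE (R : realType) (P : {poly Cplx R}) :
  critical_points (exp_plus_poly P) = [set z | exp_plus_poly P^`() z = 0].
Proof.
have D z := is_derive_exp_plus_poly P z.
apply/seteqP; split => z /=; rewrite /critical_points /=.
  by move=> /@derive_val <-; rewrite derive_val.
by move=> gz; have := D z; rewrite gz.
Qed.

Lemma critical_value_horner (R : realType) (P : {poly Cplx R}) (z : Cplx R) :
  exp_plus_poly P^`() z = 0 -> exp_plus_poly P z = (P - P^`()).[z].
Proof.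
rewrite /exp_plus_poly hornerD hornerN => /eqP; rewrite addr_eq0 => /eqP ->.
by rewrite addrC.
Qed.

Lemma size_sub_deriv (R : realType) (P : {poly Cplx R}) : (1 < size P)%N ->
  (1 < size (P - P^`())%R)%N /\ P^`() != 0.
Proof.
move=> P1; have P0 : P != 0 by rewrite -size_poly_gt0 ltnW.
split.
  by rewrite size_polyDl// size_polyN; exact: lt_size_deriv.
rewrite -lead_coef_eq0 lead_coefE in P0.
apply: contra_neq P0 => dP0; have := coef_deriv P (size P).-2.
rewrite dP0 coef0 => /esym/eqP; rewrite mulrn_eq0 /= prednK; last first.
  by case: (size P) P1 => [|[|]].
by move/eqP.
Qed.

Theorem corollary1p2p1 (R : realType) (P : {poly Cplx R}) (hP : (1 < size P)%N) :
  limit_point (critical_values (exp_plus_poly P)) = [set infty_pt R] /\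
  forall a : Cplx R,
    limit_point (mero_critical_values (recip_plus (exp_plus_poly P) a))
      = [set fin_pt a].
Proof.
have [szD dP0] := size_sub_deriv hP.
set f := exp_plus_poly P.
pose V := f @` [set z | exp_plus_poly P^`() z = 0].
have finV M : finite_set [set v | V v /\ modulus v <= M].
  have [r rM] := horner_unbounded (M + 1) szD.
  apply: sub_finite_set (finite_image f (finite_zeros_in_disc P^`() r)).
  move=> _ [[z gz <-] fM]; exists z => //; split => //.
  rewrite leNgt; apply/negP => /ltW/rM.
  by rewrite -critical_value_horner// leNgt => /negP; apply; rewrite -/f; lra.
have unbV M : exists2 v, V v & M < modulus v.
  have [r rM] := horner_unbounded (M + 1) szD.
  have [z rz gz] := far_zeros r dP0.
  exists (f z); first by exists z.
  by rewrite /f critical_value_horner//; have := rM _ rz; lra.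
split.
  have -> : critical_values f = @fin_pt R @` V.
    by rewrite /critical_values critical_pointsE -image_comp.
  exact: limit_point_infty.
(* The derivative of 1 / f + a at a point where f does not vanish is a nonzero
   multiple of that of f, so the two functions have the same critical points
   there. *)
move=> a; have Dr z : f z != 0 ->
    is_derive z 1 (fun w => (f w)^-1 + a) (- (f z) ^- 2 * exp_plus_poly P^`() z).
  move=> fz; have Df := is_derive_exp_plus_poly P z.
  have DV : is_derive z 1 (fun w => (f w)^-1)
      (- (f z) ^- 2 *: exp_plus_poly P^`() z).
    by apply: DeriveDef; [exact: derivableV|rewrite deriveV// derive_val].
  by apply: (is_derive_eq (is_deriveD DV (is_derive_cst a z _))); rewrite addr0.
have near_recip z : f z != 0 ->
    \forall w \near z, recip_plus f a w = fin_pt ((f w)^-1 + a).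
  move=> fz; have : \forall w \near z, f w != 0.
    by have := isolated_zeros P z; apply: filterS => w zw;
      have [->|/zw] := eqVneq w z.
  by apply: filterS => w fw; rewrite /recip_plus (negbTE fw).
apply: (limit_point_recip finV unbV).
- move=> _ [z gz <-] fz; exists z; last by rewrite /recip_plus (negbTE fz).
  left; exists (fun w => (f w)^-1 + a); split; first exact: near_recip.
  by have := Dr z fz; rewrite gz mulr0.
- move=> _ [z + <-]; rewrite {2 3}/recip_plus; case: eqVneq => // fz zc _.
  exists (f z); split=> //; exists z => //=.
  case: zc => [[h [gh hz]]|[m _ [_ + _]]]; last first.
    by rewrite /recip_plus (negbTE fz).
  have fh : \forall w \near z, (f w)^-1 + a = h w.
    apply: filterS2 gh (near_recip _ fz) => w ghw gfw.
    by apply: Some_inj; rewrite -[RHS]ghw -[LHS]gfw.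
  have := near_eq_is_derive fh (Dr z fz).
  move=> /@derive_val; rewrite (@derive_val _ _ _ _ _ _ _ hz) => /esym/eqP.
  by rewrite mulf_eq0 oppr_eq0 invr_eq0 expf_eq0 /= (negbTE fz) => /eqP.
Qed.
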